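(* Let $q$ be complex with $|q|<1$ and define $$V_1(q)=q^{3}\frac{\mathfrak f(-q,-q^{27})}{\mathfrak f(-q^{13},-q^{15})},\quad V_2(q)=q^{2}\frac{\mathfrak f(-q^3,-q^{25})}{\mathfrak f(-q^{11},-q^{17})},\quad V_3(q)=q\frac{\mathfrak f(-q^5,-q^{23})}{\mathfrak f(-q^{9},-q^{19})}.$$ Then \begin{enumerate} \item[(i)] $\dfrac{1}{V_1(q)}-V_1(q)=\dfrac{\phi(q^7)\,\mathfrak f(-q^6,-q^8)}{q^3\psi(q^{14})\,\mathfrak f(-q,-q^{13})}$, \item[(ii)] $\dfrac{1}{V_1(q)}+V_1(q)=\dfrac{\phi(-q^7)\,\mathfrak f(q^6,q^8)}{q^3\psi(q^{14})\,\mathfrak f(-q,-q^{13})}$, \item[(iii)] $\dfrac{1}{V_2(q)}-V_2(q)=\dfrac{\phi(q^7)\,\mathfrak f(-q^4,-q^{10})}{q^2\psi(q^{14})\,\mathfrak f(-q^3,-q^{11})}$, \item[(iv)] $\dfrac{1}{V_2(q)}+V_2(q)=\dfrac{\phi(-q^7)\,\mathfrak f(q^4,q^{10})}{q^2\psi(q^{14})\,\mathfrak f(-q^3,-q^{11})}$, \item[(v)] $\dfrac{1}{V_3(q)}-V_3(q)=\dfrac{\phi(q^7)\,\mathfrak f(-q^2,-q^{12})}{q\,\psi(q^{14})\,\mathfrak f(-q^5,-q^{9})}$, \item[(vi)] $\dfrac{1}{V_3(q)}+V_3(q)=\dfrac{\phi(-q^7)\,\mathfrak f(q^2,q^{12})}{q\,\psi(q^{14})\,\mathfrak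 f(-q^5,-q^{9})}$, \item[(vii)] $\displaystyle\prod_{i=1}^{3}\left(\frac{1}{V_i(q)}-V_i(q)\right)=\frac{\phi^3(q^7)\psi(q)}{q^6\psi^3(q^{14})\psi(q^7)}$, \item[(viii)] $\displaystyle\prod_{i=1}^{3}\left(\frac{1}{V_i(q)}+V_i(q)\right)=\frac{\phi^3(-q^7)\phi(-q^{14})}{q^6\psi^3(q^{14})\psi(q^7)\chi(-q^2)\chi(-q)}$. \end{enumerate}
   Context: For complex $\lambda$ and $|q|<1$, $(\lambda;q)_\infty=\prod_{t\ge0}(1-\lambda q^t)$. Ramanujan's general theta function is $\mathfrak f(a,b)=\sum_{t=-\infty}^{\infty}a^{t(t+1)/2}b^{t(t-1)/2}$ for $|ab|<1$; equivalently $\mathfrak f(a,b)=(-a;ab)_\infty(-b;ab)_\infty(ab;ab)_\infty$. Further $\phi(q)=\mathfrak f(q,q)=\sum_{t\in\mathbb Z}q^{t^2}$, $\psi(q)=\mathfrak f(q,q^3)=\sum_{t\ge0}q^{t(t+1)/2}$, and $\chi(q)=(-q;q^2)_\infty$. *)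

(* Defs.v *)
From Stdlib Require Import Reals ZArith Lra.
From Coquelicot Require Import Coquelicot.
Open Scope C_scope.

(* [Series] and [Lim_seq] are only available on [R]; the complex versions are
   taken componentwise.  As in the real case they are total, and meaningful
   when the limit exists (see [Clim_seq_correct], [CSeries_correct]). *)
Definition Clim_seq (u : nat -> C) : C :=
  (real (Lim_seq (fun n => Re (u n))), real (Lim_seq (fun n => Im (u n)))).

Definition CSeries (a : nat -> C) : C := Clim_seq (sum_n a).

Definition CSeriesZ (g : Z -> C) : C :=
  CSeries (fun n => g (Z.of_nat n)) + CSeries (fun n => g (- Z.of_nat (S n))%Z).

Fixpoint Cprod_n (u : nat -> C) (n : nat) : C :=
  match n with
  | O => 1
  | S m => Cprod_n u m * u m
  end.

Definition qpoch_inf (lambda q : C) : C :=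
  Clim_seq (Cprod_n (fun t => 1 - lambda * q ^ t)).

(* Both exponents are nonnegative integers for every t in Z, so [Z.div] is
   exact and [Z.to_nat] loses nothing. *)
Definition ftheta (a b : C) : C :=
  CSeriesZ (fun t => a ^ Z.to_nat (t * (t + 1) / 2) *
                     b ^ Z.to_nat (t * (t - 1) / 2)).

Definition phi (q : C) : C := ftheta q q.

Definition psi (q : C) : C := ftheta q (q ^ 3).

Definition chi (q : C) : C := qpoch_inf (- q) (q ^ 2).

Definition V1 (q : C) : C :=
  q ^ 3 * (ftheta (- q) (- q ^ 27) / ftheta (- q ^ 13) (- q ^ 15)).

Definition V2 (q : C) : C :=
  q ^ 2 * (ftheta (- q ^ 3) (- q ^ 25) / ftheta (- q ^ 11) (- q ^ 17)).

Definition V3 (q : C) : C :=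
  q * (ftheta (- q ^ 5) (- q ^ 23) / ftheta (- q ^ 9) (- q ^ 19)).

Lemma Clim_seq_correct (u : nat -> C) (l : C) :
  filterlim u eventually (locally l) -> Clim_seq u = l.
Proof.
intros H. destruct l as [x y]. unfold Clim_seq.
rewrite (is_lim_seq_unique (fun n => Re (u n)) x).
rewrite (is_lim_seq_unique (fun n => Im (u n)) y).
reflexivity.
- apply is_lim_seq_spec. intros eps.
  assert (P : locally ((x, y) : C) (fun z : C => ball y eps (Im z))).
  { exists eps. intros z Hz. apply Hz. }
  exact (H _ P).
- apply is_lim_seq_spec. intros eps.
  assert (P : locally ((x, y) : C) (fun z : C => ball x eps (Re z))).
  { exists eps. intros z Hz. apply Hz. }
  exact (H _ P).
Qed.

Lemma CSeries_correct (a : nat -> C) (l : C) :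
  is_series a l -> CSeries a = l.
Proof. exact (Clim_seq_correct (sum_n a) l). Qed.

(* Main.v *)
Require Import Defs.
From Stdlib Require Import Reals ZArith Lra Lia.
From Coquelicot Require Import Coquelicot.
Open Scope C_scope.

(** By the Jacobi triple product, [f(a,b) f(-a,-b) = f(-a^2,-b^2) phi(-ab)].
    Splitting the series of [f(a,ac)] by the parity of the index gives
    [f(a,ac) = f(a^4 c, a^4 c^3) + a f(c, a^8 c^3)], and replacing [a] by [-a]
    changes the sign of the second term; hence
    [f(a^4 c, a^4 c^3)^2 - a^2 f(c, a^8 c^3)^2 = f(-a^2, -a^2 c^2) phi(-a^2 c)].
    With [a = q^3, q^2, q] and [c = -q, -q^3, -q^5] this is the numerator of
    [1/V_i - V_i]; with [Ci * a] in place of [a] it is that of [1/V_i + V_i].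
    The denominators satisfy
    [f(c, a^8 c^3) f(a^4 c, a^4 c^3) = f(c, a^4 c) psi(a^4 c^2)], again by the
    triple product, and (vii), (viii) follow from (i)-(vi) by splitting
    q-Pochhammer products of base [q^2] into seven of base [q^14]. *)

(** Extensionality lemmas for [sum_n] leave equations over the carrier of an algebraic structure;
    restating them over [C] lets [ring] recognise them. *)
Ltac Cring := match goal with |- @eq _ ?x ?y => change (@eq C x y) end; ring.

(** * Convergence of complex sequences *)

(** Convergence is taken by coordinates, as in [Clim_seq], so that facts on real limits apply
    directly. *)
Definition Cconv (u : nat -> C) (l : C) : Prop :=
  is_lim_seq (fun n => Re (u n)) (Re l) /\ is_lim_seq (fun n => Im (u n)) (Im l).

Lemma Cconv_lim (u : nat -> C) (l : C) : Cconv u l -> Clim_seq u = l.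
Proof.
intros [Hr Hi]. unfold Clim_seq.
rewrite (is_lim_seq_unique _ _ Hr), (is_lim_seq_unique _ _ Hi).
destruct l; reflexivity.
Qed.

Lemma Cconv_unique (u : nat -> C) (l l' : C) : Cconv u l -> Cconv u l' -> l = l'.
Proof. intros H H'. rewrite <- (Cconv_lim _ _ H). apply Cconv_lim, H'. Qed.

Lemma Cconv_ext (u v : nat -> C) (l : C) :
  (forall n, u n = v n) -> Cconv u l -> Cconv v l.
Proof.
intros E [Hr Hi].
split; [apply (is_lim_seq_ext (fun n => Re (u n))) | apply (is_lim_seq_ext (fun n => Im (u n)))];
  auto; intros n; now rewrite E.
Qed.

Lemma Cconv_const (c : C) : Cconv (fun _ => c) c.
Proof. split; apply is_lim_seq_const. Qed.

Lemma Cconv_plus (u v : nat -> C) (l m : C) :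
  Cconv u l -> Cconv v m -> Cconv (fun n => u n + v n) (l + m).
Proof. intros [Hr Hi] [Hr' Hi']; split; now apply is_lim_seq_plus'. Qed.

Lemma Cconv_mult (u v : nat -> C) (l m : C) :
  Cconv u l -> Cconv v m -> Cconv (fun n => u n * v n) (l * m).
Proof.
intros [Hr Hi] [Hr' Hi']; split.
- now apply is_lim_seq_minus'; apply is_lim_seq_mult'.
- now apply is_lim_seq_plus'; apply is_lim_seq_mult'.
Qed.

Lemma Cconv_subseq (u : nat -> C) (l : C) (s : nat -> nat) :
  filterlim s eventually eventually -> Cconv u l -> Cconv (fun n => u (s n)) l.
Proof.
intros Hs [Hr Hi]; split.
- exact (is_lim_seq_subseq (fun n => Re (u n)) _ s Hs Hr).
- exact (is_lim_seq_subseq (fun n => Im (u n)) _ s Hs Hi).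
Qed.

Lemma filterlim_eventually_ge (s : nat -> nat) (k : nat) :
  (forall n, (n <= s n + k)%nat) -> filterlim s eventually eventually.
Proof.
intros H P [N HN]. exists (N + k)%nat. intros n Hn. apply HN. specialize (H n). lia.
Qed.

(** The coordinates of [/ z] are real quotients with denominator $|z|^2$, which is nonzero at the
    limit. *)
Lemma Cconv_inv (u : nat -> C) (l : C) :
  l <> 0 -> Cconv u l -> Cconv (fun n => / u n) (/ l).
Proof.
intros Hl [Hr Hi].
assert (N : (Re l ^ 2 + Im l ^ 2 <> 0)%R).
{ rewrite <- Cmod2_alt. apply pow_nonzero. intros E. now apply Hl, Cmod_eq_0. }
assert (D : is_lim_seq (fun n => Re (u n) ^ 2 + Im (u n) ^ 2)%R (Re l ^ 2 + Im l ^ 2)%R).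
{ simpl. apply is_lim_seq_plus'; repeat apply is_lim_seq_mult'; auto using is_lim_seq_const. }
split.
- now apply (is_lim_seq_div' (fun n => Re (u n)) _ (Re l)).
- apply (is_lim_seq_div' (fun n => (- Im (u n))%R) _ (- Im l)%R); auto.
  now apply (is_lim_seq_opp (fun n => Im (u n)) (Im l)).
Qed.

Lemma Cconv_Cmod (u : nat -> C) (l : C) :
  Cconv u l -> is_lim_seq (fun n => Cmod (u n)) (Cmod l).
Proof.
intros [Hr Hi]. unfold Cmod.
apply (is_lim_seq_continuous sqrt (fun n => fst (u n) ^ 2 + snd (u n) ^ 2)%R).
- apply continuity_pt_sqrt. apply Rplus_le_le_0_compat; apply pow2_ge_0.
- simpl. apply is_lim_seq_plus'; repeat apply is_lim_seq_mult'; auto using is_lim_seq_const.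
Qed.

Lemma Im_le_Cmod (z : C) : (Rabs (Im z) <= Cmod z)%R.
Proof. eapply Rle_trans; [apply Rmax_r | apply Rmax_Cmod]. Qed.

Lemma Cconv_0_Cmod (u : nat -> C) : is_lim_seq (fun n => Cmod (u n)) 0%R -> Cconv u 0.
Proof.
intros H; split; apply is_lim_seq_abs_0;
  apply (is_lim_seq_le_le (fun _ => 0%R) _ (fun n => Cmod (u n))); auto using is_lim_seq_const;
  intros n; split; try apply Rabs_pos.
- apply re_le_Cmod.
- apply Im_le_Cmod.
Qed.

Lemma sum_n_C_S (a : nat -> C) (n : nat) : sum_n a (S n) = sum_n a n + a (S n) :> C.
Proof. exact (sum_Sn a n). Qed.

Lemma sum_n_C_O (a : nat -> C) : sum_n a 0 = a 0%nat :> C.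
Proof. exact (sum_O a). Qed.

Lemma Re_sum_n (a : nat -> C) (n : nat) : Re (sum_n a n) = sum_n (fun k => Re (a k)) n.
Proof.
induction n as [|n IH]; [now rewrite sum_n_C_O, sum_O|].
now rewrite sum_n_C_S, sum_Sn, <- IH.
Qed.

Lemma Im_sum_n (a : nat -> C) (n : nat) : Im (sum_n a n) = sum_n (fun k => Im (a k)) n.
Proof.
induction n as [|n IH]; [now rewrite sum_n_C_O, sum_O|].
now rewrite sum_n_C_S, sum_Sn, <- IH.
Qed.

Lemma sum_n_C_mult_l (c : C) (a : nat -> C) (n : nat) :
  sum_n (fun k => c * a k) n = c * sum_n a n :> C.
Proof.
induction n as [|n IH]; [now rewrite !sum_n_C_O|].
rewrite !sum_n_C_S, IH; ring.
Qed.

Lemma sum_n_C_plus (a b : nat -> C) (n : nat) :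
  sum_n (fun k => a k + b k) n = sum_n a n + sum_n b n :> C.
Proof. apply (sum_n_plus a b n). Qed.

Lemma Cmod_sum_n (a : nat -> C) (n : nat) :
  (Cmod (sum_n a n) <= sum_n (fun k => Cmod (a k)) n)%R.
Proof.
induction n as [|n IH]; [rewrite sum_n_C_O, sum_O; lra|].
rewrite sum_n_C_S, sum_Sn. eapply Rle_trans; [apply Cmod_triangle|].
apply Rplus_le_compat_r, IH.
Qed.

Lemma ex_series_le_R (a b : nat -> R) :
  (forall n, (Rabs (a n) <= b n)%R) -> ex_series b -> ex_series a.
Proof. apply (ex_series_le (K := R_AbsRing) (V := R_CompleteNormedModule) a b). Qed.

(** Domination by [g] makes the real and imaginary parts summable, so the total function [CSeries]
    is here a genuine limit. *)
Lemma Cconv_series (a : nat -> C) (g : nat -> R) :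
  (forall n, (Cmod (a n) <= g n)%R) -> ex_series g -> Cconv (sum_n a) (CSeries a).
Proof.
intros H Hg.
assert (Er : ex_series (fun n => Re (a n))).
{ apply ex_series_le_R with g; auto. intros n.
  eapply Rle_trans; [apply re_le_Cmod | apply H]. }
assert (Ei : ex_series (fun n => Im (a n))).
{ apply ex_series_le_R with g; auto. intros n.
  eapply Rle_trans; [apply Im_le_Cmod | apply H]. }
assert (L : Cconv (sum_n a) (Series (fun n => Re (a n)), Series (fun n => Im (a n)))).
{ split.
  - apply (is_lim_seq_ext (sum_n (fun n => Re (a n)))).
    + intros n; now rewrite Re_sum_n.
    + now apply Series_correct.
  - apply (is_lim_seq_ext (sum_n (fun n => Im (a n)))).
    + intros n; now rewrite Im_sum_n.
    + now apply Series_correct. }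
unfold CSeries. now rewrite (Cconv_lim _ _ L).
Qed.

Lemma sum_n_R_lim0 (b : nat -> nat -> R) (K : nat) :
  (forall j, is_lim_seq (fun n => b n j) 0%R) -> is_lim_seq (fun n => sum_n (b n) K) 0%R.
Proof.
intros H. induction K as [|K IH].
- apply (is_lim_seq_ext (fun n => b n 0%nat)); auto. intros n; now rewrite sum_O.
- apply (is_lim_seq_ext (fun n => sum_n (b n) K + b n (S K))%R).
  + intros n; now rewrite sum_Sn.
  + replace 0%R with (0 + 0)%R by ring. now apply is_lim_seq_plus'.
Qed.

Lemma sum_n_R_tail_le (b g : nat -> R) (K n : nat) :
  (forall j, (b j <= g j)%R) -> (K <= n)%nat ->
  (sum_n b n <= sum_n b K + (sum_n g n - sum_n g K))%R.
Proof.
intros H Hn. induction Hn as [|n Hn IH]; [lra|].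
rewrite !sum_Sn. unfold plus; simpl. specialize (H (S n)). lra.
Qed.

(** Dominated convergence with a growing range: beyond a fixed [K] the terms are controlled by the
    tail of [g], uniformly in [n], and the finitely many others tend to zero. *)
Lemma tannery_R (b : nat -> nat -> R) (g : nat -> R) :
  (forall n j, (0 <= b n j <= g j)%R) -> ex_series g ->
  (forall j, is_lim_seq (fun n => b n j) 0%R) ->
  is_lim_seq (fun n => sum_n (b n) n) 0%R.
Proof.
intros Hb [S HS] H0.
assert (HS' : is_lim_seq (sum_n g) S) by exact HS.
apply is_lim_seq_spec. intros eps.
apply is_lim_seq_spec in HS'.
(* Two partial sums of [g] within [eps / 4] of the limit differ by less than [eps / 2]; the other
   half is spent on the indices up to [K]. *)
destruct (HS' (pos_div_2 (pos_div_2 eps))) as [K HK].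
generalize (sum_n_R_lim0 b K H0); intros HL. apply is_lim_seq_spec in HL.
destruct (HL (pos_div_2 eps)) as [N HN].
exists (K + N)%nat. intros n Hn.
generalize (HK K (le_n _)) (HK n ltac:(lia)) (HN n ltac:(lia)); simpl.
generalize (sum_n_R_tail_le (b n) g K n (fun j => proj2 (Hb n j)) ltac:(lia)).
assert (P : (0 <= sum_n (b n) n)%R).
{ clear - Hb. generalize n at 2. intros m. induction m as [|m IH].
  - rewrite sum_O; apply Hb.
  - rewrite sum_Sn. apply Rplus_le_le_0_compat; [exact IH | apply Hb]. }
intros A B D E. apply Rabs_def2 in B, D, E. apply Rabs_def1; simpl in *; lra.
Qed.

(** Tannery's theorem. Subtracting [l] from the coefficients reduces it to the null case
    [tannery_R]. *)
Lemma tannery (c : nat -> nat -> C) (u : nat -> C) (l : C) (M : R) :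
  (forall n j, (Cmod (c n j) <= M)%R) -> ex_series (fun j => Cmod (u j)) ->
  (forall j, Cconv (fun n => c n j) l) ->
  Cconv (fun n => sum_n (fun j => c n j * u j) n) (l * CSeries u).
Proof.
intros HM Hu Hc.
(* The limit inherits the bound, whence the factor [2 * M] in the dominating series below. *)
assert (Hl : (Cmod l <= M)%R).
{ apply (is_lim_seq_le (fun n => Cmod (c n 0%nat)) (fun _ => M) (Cmod l) M); auto.
  - now apply Cconv_Cmod.
  - apply is_lim_seq_const. }
apply (Cconv_ext (fun n => l * sum_n u n + sum_n (fun j => (c n j - l) * u j) n)).
{ intros n. rewrite <- sum_n_C_mult_l, <- sum_n_C_plus. apply sum_n_ext. intros j; Cring. }
rewrite <- (Cplus_0_r (l * CSeries u)). apply Cconv_plus.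
- apply Cconv_mult; [apply Cconv_const|].
  apply Cconv_series with (fun j => Cmod (u j)); auto. intros; lra.
- apply Cconv_0_Cmod.
  apply (is_lim_seq_le_le (fun _ => 0%R) _
           (fun n => sum_n (fun j => Cmod ((c n j - l) * u j)) n)).
  + intros n; split; [apply Cmod_ge_0 | apply Cmod_sum_n].
  + apply is_lim_seq_const.
  + apply (tannery_R (fun n j => Cmod ((c n j - l) * u j)) (fun j => scal (2 * M)%R (Cmod (u j)))).
    * intros n j; split; [apply Cmod_ge_0|]. rewrite Cmod_mult.
      apply Rmult_le_compat_r; [apply Cmod_ge_0|].
      eapply Rle_trans; [apply Cmod_triangle|]. rewrite Cmod_opp.
      specialize (HM n j). lra.
    * now apply (ex_series_scal (V := R_NormedModule)).
    * intros j.
      assert (E : Cconv (fun n => (c n j - l) * u j) ((l + - l) * u j)).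
      { apply Cconv_mult; [|apply Cconv_const].
        apply Cconv_plus; [apply Hc | apply Cconv_const]. }
      replace ((l + - l) * u j) with (RtoC 0) in E by ring.
      apply Cconv_Cmod in E. now rewrite Cmod_0 in E.
Qed.

Lemma Cconv_incr_1 (u : nat -> C) (l : C) : Cconv (fun n => u (S n)) l -> Cconv u l.
Proof.
intros [Hr Hi]; split.
- now apply (is_lim_seq_incr_1 (fun n => Re (u n))).
- now apply (is_lim_seq_incr_1 (fun n => Im (u n))).
Qed.

Lemma Cconv_bounded (u : nat -> C) (l : C) :
  Cconv u l -> exists M, (0 < M)%R /\ forall n, (Cmod (u n) <= M)%R.
Proof.
intros H. apply Cconv_Cmod, is_lim_seq_Reals in H.
destruct (maj_by_pos (fun n => Cmod (u n)) (exist _ _ H)) as [M [HM HB]].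
exists M; split; auto. intros n. specialize (HB n).
now rewrite Rabs_pos_eq in HB by apply Cmod_ge_0.
Qed.

(** * Infinite products *)

Lemma Cprod_n_ext (u v : nat -> C) (n : nat) :
  (forall k, u k = v k) -> Cprod_n u n = Cprod_n v n.
Proof. intros E. induction n as [|n IH]; simpl; [|rewrite IH, E]; reflexivity. Qed.

Lemma Cprod_n_mult (u v : nat -> C) (n : nat) :
  Cprod_n (fun k => u k * v k) n = Cprod_n u n * Cprod_n v n.
Proof. induction n as [|n IH]; simpl; [|rewrite IH]; ring. Qed.

Lemma Cprod_n_add (u : nat -> C) (m n : nat) :
  Cprod_n u (m + n) = Cprod_n u m * Cprod_n (fun k => u (m + k)%nat) n.
Proof.
induction n as [|n IH]; simpl; [rewrite Nat.add_0_r; ring|].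
rewrite Nat.add_succ_r; simpl. rewrite IH; ring.
Qed.

Lemma Cprod_n_head (u : nat -> C) (n : nat) :
  Cprod_n u (S n) = u 0%nat * Cprod_n (fun k => u (S k)) n.
Proof. change (S n) with (1 + n)%nat. rewrite Cprod_n_add. simpl; ring. Qed.

Lemma Cprod_n_neq_0 (u : nat -> C) (n : nat) :
  (forall k, u k <> 0) -> Cprod_n u n <> 0.
Proof.
intros H. induction n as [|n IH]; simpl.
- intros E. apply (f_equal Re) in E. simpl in E. lra.
- now apply Cmult_neq_0.
Qed.

Lemma Cconv_Cprod_n (u : nat -> nat -> C) (l : nat -> C) (m : nat) :
  (forall i, Cconv (u i) (l i)) ->
  Cconv (fun n => Cprod_n (fun i => u i n) m) (Cprod_n l m).
Proof.
intros H. induction m as [|m IH]; simpl.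
- apply Cconv_const.
- now apply Cconv_mult.
Qed.

Definition qpoch (x p : C) (n : nat) : C := Cprod_n (fun t => 1 - x * p ^ t) n.

Lemma qpoch_S (x p : C) (n : nat) : qpoch x p (S n) = qpoch x p n * (1 - x * p ^ n).
Proof. reflexivity. Qed.

(** The quotient is the geometric sum of the first [n] powers in closed form; this recurrence drives
    both bounds on [qpoch]. *)
Lemma Rgeom_step (r : R) (n : nat) :
  (r < 1)%R -> ((1 - r ^ S n) / (1 - r) = (1 - r ^ n) / (1 - r) + r ^ n)%R.
Proof. intros H. simpl. field. lra. Qed.

Lemma Rgeom_le (r : R) (n : nat) :
  (0 <= r < 1)%R -> (0 <= (1 - r ^ n) / (1 - r) <= / (1 - r))%R.
Proof.
intros H.
assert (0 <= r ^ n <= 1)%R.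
{ split; [apply pow_le; lra|]. rewrite <- (pow1 n). apply pow_incr; lra. }
assert (0 < / (1 - r))%R by (apply Rinv_0_lt_compat; lra).
unfold Rdiv. split; nra.
Qed.

Lemma Cmod_mult_pow (x p : C) (t : nat) : Cmod (x * p ^ t) = (Cmod x * Cmod p ^ t)%R.
Proof. now rewrite Cmod_mult, Cmod_pow. Qed.

(** Each factor satisfies $|1-xp^t|\le 1+|x||p|^t\le\exp(|x||p|^t)$, and the exponents form a
    geometric series. *)
Lemma qpoch_upper_bound (x p : C) (n : nat) :
  (Cmod p < 1)%R -> (Cmod (qpoch x p n) <= exp (Cmod x * / (1 - Cmod p)))%R.
Proof.
intros Hp. pose proof (Cmod_ge_0 p) as Hp0. pose proof (Cmod_ge_0 x) as Hx0.
(* The induction needs the partial geometric sum; it is enlarged to the full sum only afterwards. *)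
assert (H : (Cmod (qpoch x p n) <= exp (Cmod x * ((1 - Cmod p ^ n) / (1 - Cmod p))))%R).
{ induction n as [|n IH].
  - unfold qpoch; simpl Cprod_n; simpl pow. rewrite Cmod_1. unfold Rdiv. rewrite Rminus_diag, Rmult_0_l, Rmult_0_r, exp_0. lra.
  - rewrite Rgeom_step by lra. rewrite Rmult_plus_distr_l, exp_plus.
    unfold qpoch; simpl Cprod_n. rewrite Cmod_mult.
    apply Rmult_le_compat; auto using Cmod_ge_0.
    eapply Rle_trans; [apply Cmod_triangle|].
    rewrite Cmod_opp, Cmod_1, Cmod_mult_pow. apply exp_ineq1_le. }
eapply Rle_trans; [apply H|].
pose proof (Rgeom_le (Cmod p) n (conj Hp0 Hp)) as G.
assert (L : (Cmod x * ((1 - Cmod p ^ n) / (1 - Cmod p)) <= Cmod x * / (1 - Cmod p))%R)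
  by (apply Rmult_le_compat_l; lra).
destruct L as [L | ->]; [left; now apply exp_increasing | right; reflexivity].
Qed.

(** Summing the differences of consecutive products turns convergence of the product into that of a
    series with geometrically bounded terms. *)
Lemma qpoch_telescope (x p : C) (n : nat) :
  qpoch x p (S n) = 1 + sum_n (fun k => - qpoch x p k * (x * p ^ k)) n.
Proof.
induction n as [|n IH].
- rewrite sum_n_C_O. unfold qpoch; simpl. ring.
- rewrite sum_n_C_S, Cplus_assoc, <- IH, (qpoch_S x p (S n)). ring.
Qed.

Lemma qpoch_conv (x p : C) : (Cmod p < 1)%R -> Cconv (qpoch x p) (qpoch_inf x p).
Proof.
intros Hp.
assert (H : exists l, Cconv (qpoch x p) l).
{ exists (1 + CSeries (fun k => - qpoch x p k * (x * p ^ k))). apply Cconv_incr_1.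
  apply (Cconv_ext (fun n => 1 + sum_n (fun k => - qpoch x p k * (x * p ^ k)) n)).
  { intros n. now rewrite qpoch_telescope. }
  apply Cconv_plus; [apply Cconv_const|].
  apply Cconv_series with
    (fun k => scal (exp (Cmod x * / (1 - Cmod p)) * Cmod x)%R (Cmod p ^ k)%R).
  - intros k. rewrite Cmod_mult, Cmod_opp, Cmod_mult_pow.
    unfold scal; simpl; unfold mult; simpl. rewrite Rmult_assoc.
    apply Rmult_le_compat_r; [|now apply qpoch_upper_bound].
    rewrite <- Cmod_mult_pow. apply Cmod_ge_0.
  - apply (ex_series_scal (V := R_NormedModule)), ex_series_geom.
    rewrite Rabs_pos_eq; auto using Cmod_ge_0. }
destruct H as [l H].
replace (qpoch_inf x p) with l; auto. symmetry. apply Cconv_lim, H.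
Qed.

Lemma Cmod_1_minus (z : C) : (1 - Cmod z <= Cmod (1 - z))%R.
Proof.
pose proof (Cmod_triangle (1 - z) z) as H. replace (1 - z + z) with (RtoC 1) in H by ring.
rewrite Cmod_1 in H. lra.
Qed.

Lemma one_minus_neq_0 (z : C) : (Cmod z < 1)%R -> 1 - z <> 0.
Proof.
intros H. apply Cmod_gt_0. pose proof (Cmod_1_minus z). lra.
Qed.

(** Weierstrass' inequality, from $(1-g)(1-r)\ge 1-g-r$ for $g,r\ge0$. The bound on [x] keeps every
    factor $1-|x||p|^t$ nonnegative. *)
Lemma qpoch_lower_bound (x p : C) (n : nat) :
  (Cmod p < 1)%R -> (Cmod x <= 1 - Cmod p)%R ->
  (1 - Cmod x * ((1 - Cmod p ^ n) / (1 - Cmod p)) <= Cmod (qpoch x p n))%R.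
Proof.
intros Hp Hx. pose proof (Cmod_ge_0 p) as Hp0. pose proof (Cmod_ge_0 x) as Hx0.
induction n as [|n IH].
- unfold qpoch; simpl Cprod_n; simpl pow. rewrite Cmod_1. unfold Rdiv. rewrite Rminus_diag, Rmult_0_l. lra.
- rewrite Rgeom_step by lra. unfold qpoch; simpl Cprod_n. rewrite Cmod_mult.
  fold (qpoch x p n).
  pose proof (Cmod_1_minus (x * p ^ n)) as L. rewrite Cmod_mult_pow in L.
  pose proof (Rgeom_le (Cmod p) n (conj Hp0 Hp)) as G.
  assert (P : (0 <= Cmod p ^ n <= 1)%R).
  { split; [apply pow_le; lra|]. rewrite <- (pow1 n). apply pow_incr; lra. }
  set (g := ((1 - Cmod p ^ n) / (1 - Cmod p))%R) in *.
  set (r := (Cmod p ^ n)%R) in *. set (P' := Cmod (qpoch x p n)) in *.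
  assert (P0 : (0 <= P')%R) by apply Cmod_ge_0.
  assert (X1 : (0 <= Cmod x * r <= 1)%R) by (split; nra).
  assert (X2 : (0 <= Cmod x * g)%R) by (apply Rmult_le_pos; lra).
  apply Rle_trans with (P' * (1 - Cmod x * r))%R; [|apply Rmult_le_compat_l; lra].
  apply Rle_trans with ((1 - Cmod x * g) * (1 - Cmod x * r))%R; nra.
Qed.

Lemma qpoch_inf_shift (x p : C) (m : nat) :
  (Cmod p < 1)%R -> qpoch_inf x p = qpoch x p m * qpoch_inf (x * p ^ m) p.
Proof.
intros Hp. apply Cconv_unique with (fun n => qpoch x p (m + n)).
- apply (Cconv_subseq (qpoch x p) _ (fun n => (m + n)%nat)); [|now apply qpoch_conv].
  apply (filterlim_eventually_ge _ 0). intros; lia.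
- apply (Cconv_ext (fun n => qpoch x p m * qpoch (x * p ^ m) p n)).
  + intros n. unfold qpoch. rewrite Cprod_n_add. f_equal. apply Cprod_n_ext.
    intros k. rewrite Cpow_add_r. ring.
  + apply Cconv_mult; [apply Cconv_const | now apply qpoch_conv].
Qed.

Lemma Cmod_mult_pow_lt_1 (x p : C) (t : nat) :
  (Cmod p < 1)%R -> (Cmod x < 1)%R -> (Cmod (x * p ^ t) < 1)%R.
Proof.
intros Hp Hx. rewrite Cmod_mult_pow.
pose proof (Cmod_ge_0 p). pose proof (Cmod_ge_0 x).
assert (0 <= Cmod p ^ t <= 1)%R.
{ split; [apply pow_le; lra|]. rewrite <- (pow1 t). apply pow_incr; lra. }
nra.
Qed.

Lemma qpoch_neq_0 (x p : C) (n : nat) :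
  (Cmod p < 1)%R -> (Cmod x < 1)%R -> qpoch x p n <> 0.
Proof.
intros Hp Hx. apply Cprod_n_neq_0. intros t.
now apply one_minus_neq_0, Cmod_mult_pow_lt_1.
Qed.

(** Finitely many nonzero factors are split off until [x * p ^ m] is small; the lower bound then
    keeps the remaining product away from zero. *)
Lemma qpoch_inf_neq_0 (x p : C) :
  (Cmod p < 1)%R -> (Cmod x < 1)%R -> qpoch_inf x p <> 0.
Proof.
intros Hp Hx. pose proof (Cmod_ge_0 p) as Hp0.
(* Times the full geometric sum [/ (1 - Cmod p)] this threshold gives [1 / 2], so the remaining
   product has modulus at least [1 / 2]. *)
assert (E : exists m, (Cmod (x * p ^ m) <= (1 - Cmod p) / 2)%R).
{ destruct (pow_lt_1_zero (Cmod p) ltac:(rewrite Rabs_pos_eq; lra) ((1 - Cmod p) / 2)%R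
              ltac:(lra)) as [m Hm].
  exists m. specialize (Hm m (le_n _)). apply Rabs_def2 in Hm.
  rewrite Cmod_mult_pow. pose proof (Cmod_ge_0 x).
  assert (0 <= Cmod p ^ m)%R by (apply pow_le; lra). nra. }
destruct E as [m Hm]. rewrite (qpoch_inf_shift x p m) by auto.
apply Cmult_neq_0; [now apply qpoch_neq_0|].
apply Cmod_gt_0. apply Rlt_le_trans with (1 / 2)%R; [lra|].
apply (is_lim_seq_le (fun _ => 1 / 2)%R (fun n => Cmod (qpoch (x * p ^ m) p n))
         (1 / 2)%R (Cmod (qpoch_inf (x * p ^ m) p))).
- intros n. eapply Rle_trans; [|apply qpoch_lower_bound; auto; lra].
  pose proof (Rgeom_le (Cmod p) n (conj Hp0 Hp)) as G.
  pose proof (Cmod_ge_0 (x * p ^ m)) as X0.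
  assert (L : (Cmod (x * p ^ m) * ((1 - Cmod p ^ n) / (1 - Cmod p))
               <= (1 - Cmod p) / 2 * / (1 - Cmod p))%R)
    by (apply Rmult_le_compat; lra).
  replace ((1 - Cmod p) / 2 * / (1 - Cmod p))%R with (1 / 2)%R in L by (field; lra).
  lra.
- apply is_lim_seq_const.
- now apply Cconv_Cmod, qpoch_conv.
Qed.

(** The exponents below [m * n] are grouped by their residue modulo [m]. *)
Lemma qpoch_dissect (x p : C) (m n : nat) :
  qpoch x p (m * n) = Cprod_n (fun i => qpoch (x * p ^ i) (p ^ m) n) m.
Proof.
induction n as [|n IH].
- rewrite Nat.mul_0_r. unfold qpoch; simpl.
  induction m as [|m IH]; simpl; [|rewrite <- IH]; ring.
- rewrite Nat.mul_succ_r. unfold qpoch in *. rewrite Cprod_n_add, IH, <- Cprod_n_mult.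
  apply Cprod_n_ext. intros i. simpl. rewrite Cpow_add_r, Cpow_mult_r. ring.
Qed.

Lemma Cmod_pow_lt_1 (p : C) (m : nat) :
  (0 < m)%nat -> (Cmod p < 1)%R -> (Cmod (p ^ m) < 1)%R.
Proof.
intros Hm Hp. rewrite Cmod_pow. apply pow_lt_1_compat; auto. split; auto using Cmod_ge_0.
Qed.

Lemma qpoch_inf_dissect (x p : C) (m : nat) :
  (0 < m)%nat -> (Cmod p < 1)%R ->
  qpoch_inf x p = Cprod_n (fun i => qpoch_inf (x * p ^ i) (p ^ m)) m.
Proof.
intros Hm Hp. apply Cconv_unique with (fun n => qpoch x p (m * n)).
- apply (Cconv_subseq (qpoch x p) _ (fun n => (m * n)%nat)); [|now apply qpoch_conv].
  apply (filterlim_eventually_ge _ 0). intros; nia.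
- apply (Cconv_ext (fun n => Cprod_n (fun i => qpoch (x * p ^ i) (p ^ m) n) m)).
  + intros n. now rewrite qpoch_dissect.
  + apply (Cconv_Cprod_n (fun i => qpoch (x * p ^ i) (p ^ m))).
    intros i. now apply qpoch_conv, Cmod_pow_lt_1.
Qed.

Lemma qpoch_inf_opp (x p : C) :
  (Cmod p < 1)%R -> qpoch_inf x p * qpoch_inf (- x) p = qpoch_inf (x ^ 2) (p ^ 2).
Proof.
intros Hp. apply Cconv_unique with (qpoch (x ^ 2) (p ^ 2)).
- apply (Cconv_ext (fun n => qpoch x p n * qpoch (- x) p n)).
  + intros n. unfold qpoch. rewrite <- Cprod_n_mult. apply Cprod_n_ext. intros t.
    rewrite <- Cpow_mult_r, (Nat.mul_comm 2 t), Cpow_mult_r. ring.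
  + now apply Cconv_mult; apply qpoch_conv.
- apply qpoch_conv, Cmod_pow_lt_1; auto; lia.
Qed.

(** * The Jacobi triple product *)

Lemma sum_n_C_head (a : nat -> C) (n : nat) :
  sum_n a (S n) = a 0%nat + sum_n (fun k => a (S k)) n :> C.
Proof.
induction n as [|n IH].
- rewrite sum_n_C_S, !sum_n_C_O. reflexivity.
- rewrite sum_n_C_S, IH, (sum_n_C_S (fun k => a (S k))). ring.
Qed.

Lemma sum_n_C_rev (a : nat -> C) (n : nat) :
  sum_n (fun j => a (n - j)%nat) n = sum_n a n :> C.
Proof.
induction n as [|n IH]; [now rewrite !sum_n_C_O|].
rewrite sum_n_C_head, sum_n_C_S. simpl (S n - 0)%nat.
change (sum_n (fun k => a (S n - S k)%nat) n) with (sum_n (fun k => a (n - k)%nat) n).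
rewrite IH. ring.
Qed.

(** The lower half is read downwards from the cut, so that the q-binomial sum takes the shape of a
    bilateral series. *)
Lemma sum_n_C_split (a : nat -> C) (n m : nat) :
  sum_n a (S n + m) =
  sum_n (fun j => a (S n + j)%nat) m + sum_n (fun j => a (n - j)%nat) n :> C.
Proof.
rewrite sum_n_C_rev. induction m as [|m IH].
- rewrite Nat.add_0_r, sum_n_C_O, sum_n_C_S, Nat.add_0_r. ring.
- rewrite Nat.add_succ_r, sum_n_C_S, IH, sum_n_C_S, <- Nat.add_succ_r. ring.
Qed.

(** * The q-binomial theorem *)

(** The triangular number $n(n-1)/2$, given by recursion to avoid division. *)
Fixpoint tri (n : nat) : nat :=
  match n with O => O | S m => tri m + m end.

Lemma tri_double (n : nat) : (n + 2 * tri n = n * n)%nat.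
Proof. induction n as [|n IH]; simpl in *; lia. Qed.

(* The [k]-th elementary symmetric polynomial of [1, p, ..., p^(N-1)]. *)
Fixpoint esym (p : C) (N k : nat) : C :=
  match k, N with
  | O, _ => 1
  | S _, O => 0
  | S k', S N' => esym p N' k + p ^ N' * esym p N' k'
  end.

Lemma esym_0 (p : C) (N : nat) : esym p N 0 = 1.
Proof. destruct N; reflexivity. Qed.

Lemma esym_big (p : C) (N k : nat) : (N < k)%nat -> esym p N k = 0.
Proof.
revert k. induction N as [|N IH]; intros [|k] H; try lia; [reflexivity|].
simpl esym. rewrite !IH by lia. ring.
Qed.

Lemma esym_prod (x p : C) (N : nat) :
  Cprod_n (fun t => 1 + x * p ^ t) N = sum_n (fun k => esym p N k * x ^ k) N.
Proof.
induction N as [|N IH].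
- rewrite sum_n_C_O. cbn [Cprod_n esym Cpow]. ring.
- rewrite sum_n_C_head.
  rewrite (sum_n_ext _ (fun k => esym p N (S k) * x ^ S k + p ^ N * x * (esym p N k * x ^ k)))
    by (intros k; cbn [esym Cpow]; Cring).
  rewrite sum_n_C_plus, sum_n_C_mult_l, <- IH.
  (* Extending the range to [S N] adds a zero term, and expresses the sum with shifted index through
     the induction hypothesis. *)
  pose proof (sum_n_C_head (fun k => esym p N k * x ^ k) N) as H.
  rewrite sum_n_C_S, <- IH, (esym_big p N (S N)), !esym_0 in H by lia.
  rewrite esym_0, Cplus_assoc. cbn [Cprod_n].
  cbv beta in H. rewrite <- H. ring.
Qed.

(** This identifies [esym p N k] as $p^{k(k-1)/2}$ times a Gaussian binomial coefficient. In the
    form without division it follows from the q-Pascal recurrence. *)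
Lemma esym_closed (p : C) (N k : nat) : (k <= N)%nat ->
  esym p N k * (qpoch p p k * qpoch p p (N - k)) = p ^ tri k * qpoch p p N.
Proof.
revert k. induction N as [|N IH]; intros k Hk.
- replace k with 0%nat by lia. cbn [esym tri Cpow Nat.sub qpoch Cprod_n].
  unfold qpoch; cbn [Cprod_n]. ring.
- destruct k as [|k].
  + rewrite esym_0, Nat.sub_0_r. change (qpoch p p 0) with (RtoC 1). simpl tri. cbn [Cpow]. ring.
  + simpl Nat.sub. cbn [esym tri].
    pose proof (IH k ltac:(lia)) as H1.
    rewrite Cmult_plus_distr_r.
    replace (p ^ N * esym p N k * (qpoch p p (S k) * qpoch p p (N - k)))
      with (p ^ N * (1 - p * p ^ k) * (esym p N k * (qpoch p p k * qpoch p p (N - k))))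
      by (rewrite (qpoch_S p p k); ring).
    rewrite H1, (qpoch_S p p N), Cpow_add_r.
    (* At [k = N] one summand of the recurrence vanishes, and [N - S k] would be truncated. *)
    destruct (Nat.eq_dec k N) as [E|E].
    * rewrite esym_big by lia. subst k. ring.
    * assert (H2 : esym p N (S k) * (qpoch p p (S k) * qpoch p p (N - k)) =
                   p ^ tri (S k) * qpoch p p N * (1 - p * p ^ (N - S k))).
      { rewrite <- (IH (S k)) by lia.
        replace (N - k)%nat with (S (N - S k)) by lia.
        rewrite (qpoch_S p p (N - S k)). ring. }
      rewrite H2. cbn [tri]. rewrite Cpow_add_r.
      replace (p ^ N) with (p ^ k * (p * p ^ (N - S k))) by
        (rewrite <- Cpow_S, <- Cpow_add_r; f_equal; lia).
      ring.
Qed.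

(** * A finite form of the triple product *)

(** The summand of [ftheta a b] at index $n\ge0$; exchanging [a] and [b] gives the one at $-n$. *)
Definition theta_term (a b : C) (n : nat) : C := a ^ tri (S n) * b ^ tri n.

Lemma theta_term_S (a b : C) (n : nat) :
  theta_term a b (S n) = theta_term a b n * (a * (a * b) ^ n).
Proof.
unfold theta_term. cbn [tri]. rewrite Nat.add_succ_r, Cpow_S, !Cpow_add_r, Cpow_mult_l. ring.
Qed.

Lemma theta_term_0 (a b : C) : theta_term a b 0 = 1.
Proof. unfold theta_term. simpl tri. cbn [Cpow]. ring. Qed.

(* The factor in front makes the weight at [k = N] equal to [1], so that the two
   halves of the theta series grow out of the centre of the q-binomial theorem. *)
Definition center_weight (a b : C) (N k : nat) : C :=
  b ^ N * (a * b) ^ tri N * ((a * b) ^ tri k * (a / (a * b) ^ N) ^ k).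

(** The ratio of consecutive weights at [N + j] is $a(ab)^j$, the ratio of consecutive theta terms.
    Starting from the value [1] at the centre, induction runs in both directions. *)
Lemma center_weight_theta_term (a b : C) (N : nat) : a <> 0 -> b <> 0 ->
  (forall j, center_weight a b N (N + j) = theta_term a b j) /\
  (forall j, (j <= N)%nat -> center_weight a b N (N - j) = theta_term b a j).
Proof.
intros Ha Hb. set (p := a * b). set (w := center_weight a b N).
assert (Hp : p <> 0) by now apply Cmult_neq_0.
assert (HpN : forall n, p ^ n <> 0) by (intros; now apply Cpow_nz).
assert (HS : forall k, w (S k) = w k * (p ^ k * (a / p ^ N))).
{ intros k. unfold w, center_weight. fold p. cbn [tri]. rewrite Cpow_S, Cpow_add_r. ring. }
assert (H0 : w N = 1).
{ unfold w, center_weight, Cdiv. fold p. rewrite Cpow_mult_l, Cpow_inv, <- Cpow_mult_r by auto.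
  (* With [N * N] written as [N + 2 * tri N], the powers of [a] and of [b] cancel. *)
  rewrite <- (tri_double N).
  replace (N + 2 * tri N)%nat with (N + tri N + tri N)%nat by lia.
  rewrite !Cpow_add_r. replace (p ^ N) with (a ^ N * b ^ N) by apply eq_sym, Cpow_mult_l.
  field. repeat split; auto using Cpow_nz. }
split.
- induction j as [|j IH].
  + now rewrite Nat.add_0_r, H0, theta_term_0.
  + rewrite Nat.add_succ_r, HS, IH, theta_term_S, Cpow_add_r. fold p. field. auto.
- induction j as [|j IH]; intros Hj.
  + now rewrite Nat.sub_0_r, H0, theta_term_0.
  + specialize (IH ltac:(lia)). replace (N - j)%nat with (S (N - S j)) in IH by lia.
    rewrite HS in IH. rewrite theta_term_S, <- IH, (Cmult_comm b a). fold p.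
    replace (p ^ N) with (p ^ (N - S j) * (a * b * p ^ j)) by
      (fold p; rewrite <- Cpow_S, <- Cpow_add_r; f_equal; lia).
    field. repeat split; auto.
Qed.

(** Since $ab=p$, one has $bp^s(1+ap^{-s-1})=1+bp^s$; the prefactor collects the $bp^s$ for
    $s<N$. *)
Lemma qpoch_reverse (a b : C) (N : nat) : a <> 0 -> b <> 0 ->
  let p := a * b in
  b ^ N * p ^ tri N * Cprod_n (fun t => 1 + a / p ^ N * p ^ t) N = qpoch (- b) p N.
Proof.
intros Ha Hb p.
assert (Hp : p <> 0) by now apply Cmult_neq_0.
assert (HpN : forall n, p ^ n <> 0) by (intros; now apply Cpow_nz).
induction N as [|N IH].
- unfold qpoch. simpl tri. cbn [Cprod_n Cpow]. ring.
- rewrite qpoch_S, <- IH, Cprod_n_head.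
  rewrite (Cprod_n_ext (fun t => 1 + a / p ^ S N * p ^ S t) (fun t => 1 + a / p ^ N * p ^ t)).
  2: { intros t. rewrite !Cpow_S. field. auto. }
  cbn [tri Cpow]. rewrite Cpow_add_r.
  set (P := Cprod_n _ N). unfold p at 3. field. repeat split; auto.
Qed.

(** The Gaussian binomial coefficient of $2n$ over $n+j$, indexed by the distance from the
    centre. *)
Definition qbin_center (p : C) (n j : nat) : C :=
  qpoch p p (n + n) / (qpoch p p (n + j) * qpoch p p (n - j)).

(** The q-binomial theorem with [2 * S n] factors and $x=a/p^{n+1}$: the first half of the factors
    reverses into $(-b;p)_{n+1}$, the second is $(-a;p)_{n+1}$, and the sum is split around its
    centre. *)
Lemma finite_jacobi (a b : C) (n : nat) : a <> 0 -> b <> 0 -> (Cmod (a * b) < 1)%R ->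
  let p := a * b in
  qpoch (- a) p (S n) * qpoch (- b) p (S n) =
  sum_n (fun j => qbin_center p (S n) j * theta_term a b j) (S n) +
  sum_n (fun j => qbin_center p (S n) (S j) * theta_term b a (S j)) n.
Proof.
intros Ha Hb Hab p.
assert (Hp : p <> 0) by now apply Cmult_neq_0.
assert (HpN : forall n, p ^ n <> 0) by (intros; now apply Cpow_nz).
assert (HP : forall k, qpoch p p k <> 0) by (intros; now apply qpoch_neq_0).
destruct (center_weight_theta_term a b (S n) Ha Hb) as [W1 W2].
assert (E : forall k, (k <= S n + S n)%nat -> esym p (S n + S n) k =
  p ^ tri k * (qpoch p p (S n + S n) / (qpoch p p k * qpoch p p (S n + S n - k)))).
{ intros k Hk. unfold Cdiv. rewrite Cmult_assoc, <- esym_closed by auto. field. auto. }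
transitivity (b ^ S n * p ^ tri (S n) *
              Cprod_n (fun t => 1 + a / p ^ S n * p ^ t) (S n + S n)).
- pose proof (qpoch_reverse a b (S n) Ha Hb) as HR. cbv zeta in HR. fold p in HR.
  rewrite Cprod_n_add, Cmult_assoc, HR.
  rewrite Cmult_comm. f_equal. apply Cprod_n_ext. intros t.
  rewrite Cpow_add_r. field. auto.
- rewrite esym_prod, <- sum_n_C_mult_l, sum_n_C_split. f_equal.
  + apply sum_n_ext_loc. intros j Hj. unfold qbin_center.
    rewrite E, <- W1 by lia. unfold center_weight. fold p. replace (S n + S n - (S n + j))%nat with (S n - j)%nat by lia.
    Cring.
  + apply sum_n_ext_loc. intros j Hj. unfold qbin_center.
    rewrite E, <- W2 by lia. unfold center_weight. fold p. replace (S n - S j)%nat with (n - j)%nat by lia.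
    replace (S n + S n - (n - j))%nat with (S n + S j)%nat by lia.
    rewrite (Cmult_comm (qpoch p p (S n + S j))).
    Cring.
Qed.

(** * Passage to the limit in the finite triple product *)

(** Convergent sequences are bounded, and so are the inverses of [qpoch p p], whose limit is
    nonzero. The bound includes [j > n], as [tannery] asks. *)
Lemma qbin_center_bounded (p : C) : (Cmod p < 1)%R ->
  exists M, forall n j, (Cmod (qbin_center p n j) <= M)%R.
Proof.
intros Hp.
pose proof (qpoch_conv p p Hp) as H.
destruct (Cconv_bounded _ _ H) as [M [M0 HM]].
destruct (Cconv_bounded _ _ (Cconv_inv _ _ (qpoch_inf_neq_0 p p Hp Hp) H)) as [M' [M0' HM']].
assert (HP : forall k, qpoch p p k <> 0) by (intros; now apply qpoch_neq_0).
exists (M * (M' * M'))%R. intros n j. unfold qbin_center.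
replace (qpoch p p (n + n) / (qpoch p p (n + j) * qpoch p p (n - j)))
  with (qpoch p p (n + n) * (/ qpoch p p (n + j) * / qpoch p p (n - j))) by (field; auto).
rewrite !Cmod_mult.
apply Rmult_le_compat; auto using Cmod_ge_0.
- apply Rmult_le_pos; apply Cmod_ge_0.
- apply Rmult_le_compat; auto using Cmod_ge_0; apply HM'.
Qed.

Lemma qbin_center_conv (p : C) (j : nat) : (Cmod p < 1)%R ->
  Cconv (fun n => qbin_center p n j) (/ qpoch_inf p p).
Proof.
intros Hp.
pose proof (qpoch_conv p p Hp) as H.
pose proof (qpoch_inf_neq_0 p p Hp Hp) as Hn.
replace (/ qpoch_inf p p) with (qpoch_inf p p * / (qpoch_inf p p * qpoch_inf p p))
  by (field; auto).
apply Cconv_mult.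
- apply (Cconv_subseq (qpoch p p) _ (fun n => (n + n)%nat)); auto.
  apply (filterlim_eventually_ge _ 0). intros; lia.
- apply Cconv_inv; [now apply Cmult_neq_0|]. apply Cconv_mult.
  + apply (Cconv_subseq (qpoch p p) _ (fun n => (n + j)%nat)); auto.
    apply (filterlim_eventually_ge _ 0). intros; lia.
  + apply (Cconv_subseq (qpoch p p) _ (fun n => (n - j)%nat)); auto.
    apply (filterlim_eventually_ge _ j). intros; lia.
Qed.

Lemma theta_term_le (a b : C) (n : nat) : (Cmod a < 1)%R -> (Cmod b < 1)%R ->
  (Cmod (theta_term a b n) <= Cmod a ^ n)%R.
Proof.
intros Ha Hb. pose proof (Cmod_ge_0 a). pose proof (Cmod_ge_0 b).
induction n as [|n IH].
- rewrite theta_term_0, Cmod_1. simpl; lra.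
- rewrite theta_term_S, Cmod_mult, Cmod_mult_pow, Cmod_mult. simpl pow.
  rewrite (Rmult_comm (Cmod a) (Cmod a ^ n)).
  apply Rmult_le_compat; auto using Cmod_ge_0.
  + apply Rmult_le_pos; auto. apply pow_le. nra.
  + assert ((Cmod a * Cmod b) ^ n <= 1)%R.
    { rewrite <- (pow1 n). apply pow_incr. nra. }
    assert (0 <= (Cmod a * Cmod b) ^ n)%R by (apply pow_le; nra).
    nra.
Qed.

Lemma theta_term_ex_series (a b : C) : (Cmod a < 1)%R -> (Cmod b < 1)%R ->
  ex_series (fun n => Cmod (theta_term a b n)).
Proof.
intros Ha Hb. apply ex_series_le_R with (fun n => Cmod a ^ n)%R.
- intros n. rewrite Rabs_pos_eq by apply Cmod_ge_0. now apply theta_term_le.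
- apply ex_series_geom. now rewrite Rabs_pos_eq by apply Cmod_ge_0.
Qed.

Lemma theta_term_S_ex_series (a b : C) : (Cmod a < 1)%R -> (Cmod b < 1)%R ->
  ex_series (fun n => Cmod (theta_term a b (S n))).
Proof.
intros Ha Hb.
apply (ex_series_incr_1 (fun n => Cmod (theta_term a b n))).
now apply theta_term_ex_series.
Qed.

Lemma CSeries_ext (u v : nat -> C) : (forall n, u n = v n) -> CSeries u = CSeries v.
Proof.
intros E. unfold CSeries, Clim_seq.
f_equal; f_equal; apply Lim_seq_ext; intros n; f_equal; now apply sum_n_ext.
Qed.

Lemma tri_Z (n : nat) : Z.to_nat (Z.of_nat n * (Z.of_nat n + 1) / 2) = tri (S n).
Proof.
replace (Z.of_nat n * (Z.of_nat n + 1))%Z with (Z.of_nat (tri (S n)) * 2)%Z.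
- rewrite Z.div_mul by lia. apply Nat2Z.id.
- pose proof (tri_double (S n)). nia.
Qed.

Lemma ftheta_halves (a b : C) :
  ftheta a b = CSeries (theta_term a b) + CSeries (fun n => theta_term b a (S n)).
Proof.
unfold ftheta, CSeriesZ. f_equal; apply CSeries_ext; intros n; unfold theta_term.
- rewrite tri_Z. f_equal. f_equal. destruct n as [|n]; [reflexivity|].
  rewrite <- tri_Z. f_equal. f_equal. lia.
(* At $t=-(n+1)$ the exponents of [a] and [b] are $n(n+1)/2$ and $(n+1)(n+2)/2$: the roles of [a]
   and [b] are exchanged. *)
- rewrite Cmult_comm, <- (tri_Z n), <- (tri_Z (S n)). f_equal; f_equal; f_equal; f_equal; lia.
Qed.

(** Tannery's theorem is applied to each half of [finite_jacobi], every coefficient tending to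
    [/ qpoch_inf p p]. *)
Theorem jacobi_triple_product (a b : C) :
  a <> 0 -> b <> 0 -> (Cmod a < 1)%R -> (Cmod b < 1)%R ->
  ftheta a b = qpoch_inf (- a) (a * b) * qpoch_inf (- b) (a * b) * qpoch_inf (a * b) (a * b).
Proof.
intros Ha Hb Ha1 Hb1. set (p := a * b).
assert (Hp : (Cmod p < 1)%R).
{ unfold p. rewrite Cmod_mult. pose proof (Cmod_ge_0 a). pose proof (Cmod_ge_0 b). nra. }
pose proof (qpoch_inf_neq_0 p p Hp Hp) as Hn.
destruct (qbin_center_bounded p Hp) as [M HM].
assert (E : qpoch_inf (- a) p * qpoch_inf (- b) p =
            / qpoch_inf p p * CSeries (theta_term a b) +
            / qpoch_inf p p * CSeries (fun n => theta_term b a (S n))).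
{ apply Cconv_unique with (fun n => qpoch (- a) p (S n) * qpoch (- b) p (S n)).
  - apply Cconv_mult; [apply (Cconv_subseq (qpoch (- a) p) _ S)
                      | apply (Cconv_subseq (qpoch (- b) p) _ S)];
      try (now apply qpoch_conv); apply (filterlim_eventually_ge _ 0); intros; lia.
  - eapply Cconv_ext; [intros n; symmetry; now apply finite_jacobi|]. fold p.
    apply Cconv_plus.
    + apply (Cconv_subseq (fun n => sum_n (fun j => qbin_center p n j * theta_term a b j) n) _ S).
      * apply (filterlim_eventually_ge _ 0); intros; lia.
      * apply (tannery (qbin_center p) (theta_term a b) _ M); auto.
        -- now apply theta_term_ex_series.
        -- intros j; now apply qbin_center_conv.
    + apply (tannery (fun n j => qbin_center p (S n) (S j)) (fun n => theta_term b a (S n)) _ M);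
        auto.
      * now apply theta_term_S_ex_series.
      * intros j. apply (Cconv_subseq (fun n => qbin_center p n (S j)) _ S).
        -- apply (filterlim_eventually_ge _ 0); intros; lia.
        -- now apply qbin_center_conv. }
rewrite E, ftheta_halves. field. auto.
Qed.

(** * Theta function identities *)

(** The punctured unit disc is stable under products, positive powers, sign change and
    multiplication by [Ci]; the tactic [pdisc] settles side conditions that way. *)
Definition pdisc (z : C) : Prop := z <> 0 /\ (Cmod z < 1)%R.

Lemma pdisc_mult (x y : C) : pdisc x -> pdisc y -> pdisc (x * y).
Proof.
intros [Hx Hx1] [Hy Hy1]; split; [now apply Cmult_neq_0|].
rewrite Cmod_mult. pose proof (Cmod_ge_0 x). pose proof (Cmod_ge_0 y). nra.
Qed.

Lemma pdisc_opp (x : C) : pdisc x -> pdisc (- x).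
Proof.
intros [Hx Hx1]; split; [|now rewrite Cmod_opp].
intros E. apply Hx. replace x with (- - x) by ring. rewrite E. ring.
Qed.

Lemma pdisc_pow (x : C) (n : nat) : pdisc x -> pdisc (x ^ S n).
Proof.
intros [Hx Hx1]; split; [now apply Cpow_nz|].
apply Cmod_pow_lt_1; auto; lia.
Qed.

Lemma pdisc_Ci_mult (x : C) : pdisc x -> pdisc (Ci * x).
Proof.
intros [Hx Hx1]; split.
- apply Cmult_neq_0; auto. apply Cmod_gt_0. rewrite Cmod_Ci. lra.
- rewrite Cmod_mult, Cmod_Ci. lra.
Qed.

Ltac pdisc :=
  match goal with
  | H : pdisc ?x |- pdisc ?x => exact H
  | |- pdisc (- _) => apply pdisc_opp; pdisc
  | |- pdisc (Ci * _) => apply pdisc_Ci_mult; pdisc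
  | |- pdisc (_ * _) => apply pdisc_mult; pdisc
  | |- pdisc (_ ^ _) => apply pdisc_pow; pdisc
  | _ => idtac
  end.

(** The arguments of the products enter through equations, so that each use can choose their form
    and leave the rest to [ring]. *)
Lemma ftheta_prod (x y p a b : C) : pdisc a -> pdisc b -> - a = x -> - b = y -> a * b = p ->
  ftheta a b = qpoch_inf x p * qpoch_inf y p * qpoch_inf p p.
Proof.
intros [Ha Ha1] [Hb Hb1] <- <- <-. now apply jacobi_triple_product.
Qed.

Lemma ftheta_sym (a b : C) : pdisc a -> pdisc b -> ftheta a b = ftheta b a.
Proof.
intros Ha Hb.
rewrite (ftheta_prod (- a) (- b) (a * b)), (ftheta_prod (- b) (- a) (a * b) b) by (auto; ring).
ring.
Qed.

Lemma ftheta_neq_0 (a b : C) : pdisc a -> pdisc b -> ftheta a b <> 0.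
Proof.
intros Ha Hb. rewrite (ftheta_prod (- a) (- b) (a * b)) by auto.
assert (H : pdisc (a * b)) by pdisc.
repeat apply Cmult_neq_0; apply qpoch_inf_neq_0; rewrite ?Cmod_opp; (apply Ha || apply Hb || apply H).
Qed.

Lemma qpoch_inf_dissect2 (x p : C) : (Cmod p < 1)%R ->
  qpoch_inf x p = qpoch_inf x (p ^ 2) * qpoch_inf (x * p) (p ^ 2).
Proof.
intros Hp. rewrite (qpoch_inf_dissect x p 2) by (auto; lia). cbn [Cprod_n].
replace (x * p ^ 0) with x by ring. replace (x * p ^ 1) with (x * p) by ring. ring.
Qed.

Lemma qpoch_inf_self_dissect2 (p : C) : (Cmod p < 1)%R ->
  qpoch_inf p p = qpoch_inf p (p ^ 2) * qpoch_inf (p ^ 2) (p ^ 2).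
Proof.
intros Hp. rewrite qpoch_inf_dissect2 at 1 by auto.
now replace (p * p) with (p ^ 2) by ring.
Qed.

(** Euler's identity: $(p;p)_\infty(-p;p)_\infty$ and $(p;p)_\infty/(p;p^2)_\infty$ both equal
    $(p^2;p^2)_\infty$. *)
Lemma euler_odd_distinct (p : C) : (Cmod p < 1)%R ->
  qpoch_inf p (p ^ 2) * qpoch_inf (- p) p = 1.
Proof.
intros Hp.
assert (Hp2 : (Cmod (p ^ 2) < 1)%R) by (apply Cmod_pow_lt_1; auto; lia).
pose proof (qpoch_inf_neq_0 (p ^ 2) (p ^ 2) Hp2 Hp2) as H.
pose proof (qpoch_inf_opp p p Hp) as E. rewrite qpoch_inf_self_dissect2 in E by auto.
transitivity (qpoch_inf p (p ^ 2) * qpoch_inf (p ^ 2) (p ^ 2) * qpoch_inf (- p) p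
              / qpoch_inf (p ^ 2) (p ^ 2)).
- field. auto.
- rewrite E. field. auto.
Qed.

Lemma phi_opp_prod (p : C) : pdisc p ->
  phi (- p) = qpoch_inf p (p ^ 2) * qpoch_inf p p.
Proof.
intros Hp. unfold phi.
rewrite (ftheta_prod p p (p ^ 2)) by (pdisc; ring).
rewrite (qpoch_inf_self_dissect2 p) by apply Hp. ring.
Qed.

(** Gauss' product for $\psi$: the triple product merges to $(-p;p^2)_\infty(p^4;p^4)_\infty$, and
    $(p;p^2)_\infty(-p;p^2)_\infty=(p^2;p^4)_\infty$. *)
Lemma psi_prod (p : C) : pdisc p -> psi p * qpoch_inf p (p ^ 2) = qpoch_inf (p ^ 2) (p ^ 2).
Proof.
intros Hp. assert (H2 : pdisc (p ^ 2)) by pdisc. unfold psi.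
rewrite (ftheta_prod (- p) (- p * p ^ 2) ((p ^ 2) ^ 2)) by (pdisc; ring).
rewrite <- (qpoch_inf_dissect2 (- p) (p ^ 2)) by apply H2.
rewrite (qpoch_inf_self_dissect2 (p ^ 2)), <- (qpoch_inf_opp p (p ^ 2)) by apply H2.
ring.
Qed.

Lemma ftheta_mult_opp (a b : C) : pdisc a -> pdisc b ->
  ftheta a b * ftheta (- a) (- b) = ftheta (- a ^ 2) (- b ^ 2) * phi (- (a * b)).
Proof.
intros Ha Hb. set (p := a * b). assert (Hp : pdisc p) by (unfold p; pdisc).
rewrite phi_opp_prod by auto.
rewrite (ftheta_prod (- a) (- b) p), (ftheta_prod a b p), (ftheta_prod (a ^ 2) (b ^ 2) (p ^ 2))
  by (pdisc; unfold p; ring).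
rewrite <- (qpoch_inf_opp a p), <- (qpoch_inf_opp b p), (qpoch_inf_self_dissect2 p) by apply Hp.
ring.
Qed.

(** On the left the four products of base $p^2$ merge in pairs into base $p$, leaving
    $(p^2;p^2)_\infty^2=(p;p)_\infty\psi(p)$. *)
Lemma ftheta_mult_psi (a c : C) : pdisc a -> pdisc c ->
  ftheta c (a ^ 8 * c ^ 3) * ftheta (a ^ 4 * c) (a ^ 4 * c ^ 3) =
  ftheta c (a ^ 4 * c) * psi (a ^ 4 * c ^ 2).
Proof.
intros Ha Hc. set (p := a ^ 4 * c ^ 2). assert (Hp : pdisc p) by (unfold p; pdisc).
assert (Hn : qpoch_inf p (p ^ 2) <> 0) by
  (apply qpoch_inf_neq_0; [apply pdisc_pow, Hp | apply Hp]).
rewrite (ftheta_prod (- c) (- (a ^ 4 * c) * p) (p ^ 2)),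
  (ftheta_prod (- (a ^ 4 * c)) (- c * p) (p ^ 2)),
  (ftheta_prod (- c) (- (a ^ 4 * c)) p) by (pdisc; unfold p; ring).
rewrite (qpoch_inf_dissect2 (- c) p), (qpoch_inf_dissect2 (- (a ^ 4 * c)) p),
  (qpoch_inf_self_dissect2 p) by apply Hp.
rewrite <- (psi_prod p) by auto. ring.
Qed.

(** * Splitting theta series by parity *)

Lemma sum_n_even_odd (u : nat -> C) (n : nat) :
  sum_n u (S (2 * n)) =
  sum_n (fun m => u (2 * m)%nat) n + sum_n (fun m => u (S (2 * m))) n :> C.
Proof.
induction n as [|n IH].
- rewrite sum_n_C_S, !sum_n_C_O. reflexivity.
- replace (S (2 * S n)) with (S (S (S (2 * n)))) by lia.
  rewrite sum_n_C_S, (sum_n_C_S u (S (2 * n))), IH, !sum_n_C_S.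
  replace (2 * S n)%nat with (S (S (2 * n))) by lia. ring.
Qed.

Lemma CSeries_conv (u : nat -> C) :
  ex_series (fun n => Cmod (u n)) -> Cconv (sum_n u) (CSeries u).
Proof. intros H. apply Cconv_series with (fun n => Cmod (u n)); auto. intros; lra. Qed.

Lemma CSeries_even_odd (u v w : nat -> C) (x y : C) :
  ex_series (fun n => Cmod (u n)) -> ex_series (fun n => Cmod (v n)) ->
  ex_series (fun n => Cmod (w n)) ->
  (forall n, u (2 * n)%nat = x * v n) -> (forall n, u (S (2 * n)) = y * w n) ->
  CSeries u = x * CSeries v + y * CSeries w.
Proof.
intros Hu Hv Hw Ev Ew.
apply Cconv_unique with (fun n => sum_n u (S (2 * n))).
- apply (Cconv_subseq (sum_n u) _ (fun n => S (2 * n))); [|now apply CSeries_conv].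
  apply (filterlim_eventually_ge _ 0); intros; lia.
- apply (Cconv_ext (fun n => x * sum_n v n + y * sum_n w n)).
  + intros n. rewrite sum_n_even_odd, <- !sum_n_C_mult_l. f_equal; apply sum_n_ext; intros m; auto.
  + apply Cconv_plus; (apply Cconv_mult; [apply Cconv_const | now apply CSeries_conv]).
Qed.

Lemma Cpow_pow_comm (x : C) (m n : nat) : (x ^ m) ^ n = (x ^ n) ^ m.
Proof. now rewrite <- !Cpow_mult_r, Nat.mul_comm. Qed.

Lemma theta_term_SS (a b : C) (n : nat) :
  theta_term a b (S (S n)) = theta_term a b n * (a ^ 3 * b * ((a * b) ^ n) ^ 2).
Proof. rewrite !theta_term_S, Cpow_S. ring. Qed.

Lemma theta_term_even (a b : C) (m : nat) :
  theta_term a b (2 * m) = theta_term (a ^ 3 * b) (a * b ^ 3) m.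
Proof.
induction m as [|m IH]; [now rewrite !theta_term_0|].
replace (2 * S m)%nat with (S (S (2 * m))) by lia.
rewrite theta_term_SS, IH, theta_term_S.
rewrite Cpow_mult_r, (Cpow_pow_comm _ 2 m).
replace (a ^ 3 * b * (a * b ^ 3)) with ((a * b) ^ 4) by ring.
rewrite (Cpow_pow_comm _ 4 m). ring.
Qed.

Lemma theta_term_odd (a c : C) (m : nat) :
  theta_term a (a * c) (S (2 * m)) = a * theta_term (a ^ 8 * c ^ 3) c m.
Proof.
induction m as [|m IH].
- change (S (2 * 0)) with 1%nat. rewrite theta_term_S, !theta_term_0. cbn [Cpow]. ring.
- replace (S (2 * S m)) with (S (S (S (2 * m)))) by lia.
  rewrite theta_term_SS, IH, theta_term_S, (Cpow_S (a * (a * c)) (2 * m)).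
  rewrite Cpow_mult_r, (Cpow_pow_comm _ 2 m).
  replace (a ^ 8 * c ^ 3 * c) with ((a * (a * c)) ^ 4) by ring.
  rewrite (Cpow_pow_comm _ 4 m). ring.
Qed.

Lemma theta_term_odd_neg (a c : C) (m : nat) :
  theta_term (a * c) a (S (2 * m)) = a * theta_term c (a ^ 8 * c ^ 3) (S m).
Proof.
induction m as [|m IH].
- change (S (2 * 0)) with 1%nat. rewrite !theta_term_S, !theta_term_0. cbn [Cpow]. ring.
- replace (S (2 * S m)) with (S (S (S (2 * m)))) by lia.
  rewrite theta_term_SS, IH, (theta_term_S c _ (S m)), (Cpow_S (a * c * a) (2 * m)),
    (Cpow_S (c * (a ^ 8 * c ^ 3)) m).
  rewrite Cpow_mult_r, (Cpow_pow_comm _ 2 m).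
  replace (c * (a ^ 8 * c ^ 3)) with ((a * c * a) ^ 4) by ring.
  rewrite (Cpow_pow_comm _ 4 m). ring.
Qed.

Lemma ftheta_dissect2 (a c : C) : pdisc a -> pdisc c ->
  ftheta a (a * c) = ftheta (a ^ 4 * c) (a ^ 4 * c ^ 3) + a * ftheta c (a ^ 8 * c ^ 3).
Proof.
(* After this exchange the positive odd indices on the left correspond to nonnegative indices on the
   right. *)
intros Ha Hc. rewrite (ftheta_sym c) by pdisc.
assert (E : forall x y, pdisc x -> pdisc y -> ex_series (fun n => Cmod (theta_term x y n)))
  by (intros x y Hx Hy; apply theta_term_ex_series; [apply Hx | apply Hy]).
assert (E' : forall x y, pdisc x -> pdisc y -> ex_series (fun n => Cmod (theta_term x y (S n))))
  by (intros x y Hx Hy; apply theta_term_S_ex_series; [apply Hx | apply Hy]).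
rewrite !ftheta_halves.
rewrite (CSeries_even_odd (theta_term a (a * c)) (theta_term (a ^ 4 * c) (a ^ 4 * c ^ 3))
           (theta_term (a ^ 8 * c ^ 3) c) 1 a).
(* The negative half begins at index [1], so its even positions carry the odd indices and the two
   series change places. *)
rewrite (CSeries_even_odd (fun n => theta_term (a * c) a (S n))
           (fun n => theta_term c (a ^ 8 * c ^ 3) (S n))
           (fun n => theta_term (a ^ 4 * c ^ 3) (a ^ 4 * c) (S n)) a 1).
- ring.
- apply E'; pdisc.
- apply E'; pdisc.
- apply E'; pdisc.
- apply theta_term_odd_neg.
- intros n. replace (S (S (2 * n))) with (2 * S n)%nat by lia.
  rewrite theta_term_even, Cmult_1_l. f_equal; ring.
- apply E; pdisc.
- apply E; pdisc.
- apply E; pdisc.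
- intros n. rewrite theta_term_even, Cmult_1_l. f_equal; ring.
- apply theta_term_odd.
Qed.

Lemma ftheta_sqr_minus (a c : C) : pdisc a -> pdisc c ->
  ftheta (a ^ 4 * c) (a ^ 4 * c ^ 3) ^ 2 - a ^ 2 * ftheta c (a ^ 8 * c ^ 3) ^ 2 =
  ftheta (- a ^ 2) (- (a ^ 2 * c ^ 2)) * phi (- (a ^ 2 * c)).
Proof.
intros Ha Hc.
pose proof (ftheta_mult_opp a (a * c) Ha ltac:(pdisc)) as H.
replace (- (a * c)) with (- a * c) in H by ring.
rewrite (ftheta_dissect2 a c), (ftheta_dissect2 (- a) c) in H by pdisc.
replace ((- a) ^ 4) with (a ^ 4) in H by ring.
replace ((- a) ^ 8) with (a ^ 8) in H by ring.
replace (- (a * c) ^ 2) with (- (a ^ 2 * c ^ 2)) in H by ring.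
replace (a * (a * c)) with (a ^ 2 * c) in H by ring.
rewrite <- H. ring.
Qed.

(* The substitution [a -> Ci * a] turns the difference into a sum. *)
Lemma ftheta_sqr_plus (a c : C) : pdisc a -> pdisc c ->
  ftheta (a ^ 4 * c) (a ^ 4 * c ^ 3) ^ 2 + a ^ 2 * ftheta c (a ^ 8 * c ^ 3) ^ 2 =
  ftheta (a ^ 2) (a ^ 2 * c ^ 2) * phi (a ^ 2 * c).
Proof.
intros Ha Hc.
assert (I2 : Ci ^ 2 = - (1)) by (simpl; unfold Ci; apply injective_projections; simpl; ring).
assert (I4 : Ci ^ 4 = 1) by (transitivity ((Ci ^ 2) ^ 2); [ring | rewrite I2; ring]).
pose proof (ftheta_sqr_minus (Ci * a) c ltac:(pdisc) Hc) as H.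
replace ((Ci * a) ^ 2) with (- a ^ 2) in H by (rewrite Cpow_mult_l, I2; ring).
replace ((Ci * a) ^ 4) with (a ^ 4) in H by (rewrite Cpow_mult_l, I4; ring).
replace ((Ci * a) ^ 8) with (a ^ 8) in H.
2: { rewrite Cpow_mult_l. replace (Ci ^ 8) with ((Ci ^ 4) ^ 2) by ring. rewrite I4; ring. }
replace (- - a ^ 2) with (a ^ 2) in H by ring.
replace (- (- a ^ 2 * c ^ 2)) with (a ^ 2 * c ^ 2) in H by ring.
replace (- (- a ^ 2 * c)) with (a ^ 2 * c) in H by ring.
rewrite <- H. ring.
Qed.

(** * The quotients in terms of two parameters *)

(** For $v=aN/D$ the difference is $(D^2-a^2N^2)/(aND)$; [ftheta_sqr_minus] gives the numerator and
    [ftheta_mult_psi] the product $ND$. *)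
Lemma quotient_minus (a c : C) : pdisc a -> pdisc c ->
  let v := a * (ftheta c (a ^ 8 * c ^ 3) / ftheta (a ^ 4 * c) (a ^ 4 * c ^ 3)) in
  1 / v - v = phi (- (a ^ 2 * c)) * ftheta (- a ^ 2) (- (a ^ 2 * c ^ 2)) /
              (a * psi (a ^ 4 * c ^ 2) * ftheta c (a ^ 4 * c)).
Proof.
intros Ha Hc v. unfold v.
assert (ftheta c (a ^ 8 * c ^ 3) <> 0) by (apply ftheta_neq_0; pdisc).
assert (ftheta (a ^ 4 * c) (a ^ 4 * c ^ 3) <> 0) by (apply ftheta_neq_0; pdisc).
rewrite (Cmult_comm (phi _)), <- ftheta_sqr_minus by auto.
rewrite <- Cmult_assoc, (Cmult_comm (psi _)), <- ftheta_mult_psi by auto.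
field. repeat split; auto; apply Ha.
Qed.

Lemma quotient_plus (a c : C) : pdisc a -> pdisc c ->
  let v := a * (ftheta c (a ^ 8 * c ^ 3) / ftheta (a ^ 4 * c) (a ^ 4 * c ^ 3)) in
  1 / v + v = phi (a ^ 2 * c) * ftheta (a ^ 2) (a ^ 2 * c ^ 2) /
              (a * psi (a ^ 4 * c ^ 2) * ftheta c (a ^ 4 * c)).
Proof.
intros Ha Hc v. unfold v.
assert (ftheta c (a ^ 8 * c ^ 3) <> 0) by (apply ftheta_neq_0; pdisc).
assert (ftheta (a ^ 4 * c) (a ^ 4 * c ^ 3) <> 0) by (apply ftheta_neq_0; pdisc).
rewrite (Cmult_comm (phi _)), <- ftheta_sqr_plus by auto.
rewrite <- Cmult_assoc, (Cmult_comm (psi _)), <- ftheta_mult_psi by auto.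
field. repeat split; auto; apply Ha.
Qed.

(** * Products over residue classes modulo 14 *)

Lemma qpoch_inf_dissect7_sqr (x q : C) : pdisc q ->
  qpoch_inf x (q ^ 2) =
  qpoch_inf x (q ^ 14) * qpoch_inf (x * q ^ 2) (q ^ 14) * qpoch_inf (x * q ^ 4) (q ^ 14) *
  qpoch_inf (x * q ^ 6) (q ^ 14) * qpoch_inf (x * q ^ 8) (q ^ 14) *
  qpoch_inf (x * q ^ 10) (q ^ 14) * qpoch_inf (x * q ^ 12) (q ^ 14).
Proof.
intros Hq. rewrite (qpoch_inf_dissect x (q ^ 2) 7) by (lia || apply pdisc_pow, Hq).
cbn [Cprod_n]. replace ((q ^ 2) ^ 7) with (q ^ 14) by ring.
rewrite <- !Cpow_mult_r. simpl Nat.mul. replace (x * q ^ 0) with x by ring. ring.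
Qed.

Lemma qpoch_inf_odd7 (q : C) : pdisc q ->
  qpoch_inf q (q ^ 2) =
  qpoch_inf q (q ^ 14) * qpoch_inf (q ^ 3) (q ^ 14) * qpoch_inf (q ^ 5) (q ^ 14) *
  qpoch_inf (q ^ 7) (q ^ 14) * qpoch_inf (q ^ 9) (q ^ 14) *
  qpoch_inf (q ^ 11) (q ^ 14) * qpoch_inf (q ^ 13) (q ^ 14).
Proof. intros Hq. now rewrite qpoch_inf_dissect7_sqr, <- !Cpow_S by auto. Qed.

Lemma qpoch_inf_even7 (q : C) : pdisc q ->
  qpoch_inf (q ^ 2) (q ^ 2) =
  qpoch_inf (q ^ 2) (q ^ 14) * qpoch_inf (q ^ 4) (q ^ 14) * qpoch_inf (q ^ 6) (q ^ 14) *
  qpoch_inf (q ^ 8) (q ^ 14) * qpoch_inf (q ^ 10) (q ^ 14) *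
  qpoch_inf (q ^ 12) (q ^ 14) * qpoch_inf (q ^ 14) (q ^ 14).
Proof. intros Hq. now rewrite qpoch_inf_dissect7_sqr, <- !Cpow_add_r by auto. Qed.

Lemma qpoch_inf_opp_even7 (q : C) : pdisc q ->
  qpoch_inf (- q ^ 2) (q ^ 2) =
  qpoch_inf (- q ^ 2) (q ^ 14) * qpoch_inf (- q ^ 4) (q ^ 14) * qpoch_inf (- q ^ 6) (q ^ 14) *
  qpoch_inf (- q ^ 8) (q ^ 14) * qpoch_inf (- q ^ 10) (q ^ 14) *
  qpoch_inf (- q ^ 12) (q ^ 14) * qpoch_inf (- q ^ 14) (q ^ 14).
Proof.
intros Hq. rewrite qpoch_inf_dissect7_sqr by auto.
assert (E : forall k, - q ^ 2 * q ^ k = - q ^ (2 + k)) by (intros; rewrite Cpow_add_r; ring).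
now rewrite !E.
Qed.

(** The odd residues $r$ and $14-r$ pair into three theta functions; the residue 7 stays alone. *)
Lemma ftheta_odd_product (q : C) : pdisc q ->
  ftheta (- q) (- q ^ 13) * ftheta (- q ^ 3) (- q ^ 11) * ftheta (- q ^ 5) (- q ^ 9)
    * qpoch_inf (q ^ 7) (q ^ 14)
  = qpoch_inf q (q ^ 2) * qpoch_inf (q ^ 14) (q ^ 14) ^ 3.
Proof.
intros Hq.
rewrite (ftheta_prod q (q ^ 13) (q ^ 14)), (ftheta_prod (q ^ 3) (q ^ 11) (q ^ 14)),
  (ftheta_prod (q ^ 5) (q ^ 9) (q ^ 14)) by (pdisc; ring).
rewrite qpoch_inf_odd7 by auto. ring.
Qed.

(** The nonzero even residues pair up; the residue 0 supplies one factor $(q^{14};q^{14})_\infty$,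
    hence the exponent 2. *)
Lemma ftheta_even_product (q : C) : pdisc q ->
  ftheta (- q ^ 6) (- q ^ 8) * ftheta (- q ^ 4) (- q ^ 10) * ftheta (- q ^ 2) (- q ^ 12)
  = qpoch_inf (q ^ 2) (q ^ 2) * qpoch_inf (q ^ 14) (q ^ 14) ^ 2.
Proof.
intros Hq.
rewrite (ftheta_prod (q ^ 6) (q ^ 8) (q ^ 14)), (ftheta_prod (q ^ 4) (q ^ 10) (q ^ 14)),
  (ftheta_prod (q ^ 2) (q ^ 12) (q ^ 14)) by (pdisc; ring).
rewrite qpoch_inf_even7 by auto. ring.
Qed.

Lemma ftheta_opp_even_product (q : C) : pdisc q ->
  ftheta (q ^ 6) (q ^ 8) * ftheta (q ^ 4) (q ^ 10) * ftheta (q ^ 2) (q ^ 12)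
    * qpoch_inf (- q ^ 14) (q ^ 14)
  = qpoch_inf (- q ^ 2) (q ^ 2) * qpoch_inf (q ^ 14) (q ^ 14) ^ 3.
Proof.
intros Hq.
rewrite (ftheta_prod (- q ^ 6) (- q ^ 8) (q ^ 14)), (ftheta_prod (- q ^ 4) (- q ^ 10) (q ^ 14)),
  (ftheta_prod (- q ^ 2) (- q ^ 12) (q ^ 14)) by (pdisc; ring).
rewrite qpoch_inf_opp_even7 by auto. ring.
Qed.

(** The case $a=q^m$, $c=-q^k$ of [quotient_minus]; for numerals [m] and [k] the exponents compute
    to those of the theorem. *)
Lemma quotient_minus_pow (q : C) (m k : nat) : pdisc (q ^ m) -> pdisc (q ^ k) ->
  let v := q ^ m * (ftheta (- q ^ k) (- q ^ (m * 8 + k * 3)) /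
                    ftheta (- q ^ (m * 4 + k)) (- q ^ (m * 4 + k * 3))) in
  1 / v - v = phi (q ^ (m * 2 + k)) * ftheta (- q ^ (m * 2)) (- q ^ (m * 2 + k * 2)) /
              (q ^ m * psi (q ^ (m * 4 + k * 2)) * ftheta (- q ^ k) (- q ^ (m * 4 + k))).
Proof.
intros Hm Hk.
pose proof (quotient_minus (q ^ m) (- q ^ k) Hm ltac:(pdisc)) as H.
rewrite !Cpow_add_r, !Cpow_mult_r.
set (a := q ^ m) in *. set (c := q ^ k) in *.
replace (a ^ 8 * (- c) ^ 3) with (- (a ^ 8 * c ^ 3)) in H by ring.
replace (a ^ 4 * - c) with (- (a ^ 4 * c)) in H by ring.
replace (a ^ 4 * (- c) ^ 3) with (- (a ^ 4 * c ^ 3)) in H by ring.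
replace (- (a ^ 2 * - c)) with (a ^ 2 * c) in H by ring.
replace ((- c) ^ 2) with (c ^ 2) in H by ring.
exact H.
Qed.

Lemma quotient_plus_pow (q : C) (m k : nat) : pdisc (q ^ m) -> pdisc (q ^ k) ->
  let v := q ^ m * (ftheta (- q ^ k) (- q ^ (m * 8 + k * 3)) /
                    ftheta (- q ^ (m * 4 + k)) (- q ^ (m * 4 + k * 3))) in
  1 / v + v = phi (- q ^ (m * 2 + k)) * ftheta (q ^ (m * 2)) (q ^ (m * 2 + k * 2)) /
              (q ^ m * psi (q ^ (m * 4 + k * 2)) * ftheta (- q ^ k) (- q ^ (m * 4 + k))).
Proof.
intros Hm Hk.
pose proof (quotient_plus (q ^ m) (- q ^ k) Hm ltac:(pdisc)) as H.
rewrite !Cpow_add_r, !Cpow_mult_r.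
set (a := q ^ m) in *. set (c := q ^ k) in *.
replace (a ^ 8 * (- c) ^ 3) with (- (a ^ 8 * c ^ 3)) in H by ring.
replace (a ^ 4 * - c) with (- (a ^ 4 * c)) in H by ring.
replace (a ^ 4 * (- c) ^ 3) with (- (a ^ 4 * c ^ 3)) in H by ring.
replace (a ^ 2 * - c) with (- (a ^ 2 * c)) in H by ring.
replace ((- c) ^ 2) with (c ^ 2) in H by ring.
exact H.
Qed.

Lemma Cmult_reg_r (z x y : C) : z <> 0 -> x * z = y * z -> x = y.
Proof.
intros Hz E. transitivity (x * z / z); [field; auto|]. rewrite E. field; auto.
Qed.

(** Multiplied by $(q^7;q^{14})_\infty$, both sides become
    $(q^2;q^2)_\infty(q^{14};q^{14})_\infty^3$. *)
Lemma ftheta_product_psi (q : C) : pdisc q ->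
  ftheta (- q ^ 6) (- q ^ 8) * ftheta (- q ^ 4) (- q ^ 10) * ftheta (- q ^ 2) (- q ^ 12)
    * psi (q ^ 7)
  = psi q *
    (ftheta (- q) (- q ^ 13) * ftheta (- q ^ 3) (- q ^ 11) * ftheta (- q ^ 5) (- q ^ 9)).
Proof.
intros Hq.
assert (H7 : qpoch_inf (q ^ 7) (q ^ 14) <> 0)
  by (apply qpoch_inf_neq_0; apply pdisc_pow, Hq).
apply (Cmult_reg_r (qpoch_inf (q ^ 7) (q ^ 14))); auto.
pose proof (psi_prod (q ^ 7) ltac:(pdisc)) as P7.
rewrite <- Cpow_mult_r in P7. simpl Nat.mul in P7.
rewrite <- (Cmult_assoc (psi q)), ftheta_odd_product, ftheta_even_product,
  <- Cmult_assoc, P7, <- psi_prod by auto.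
ring.
Qed.

Lemma ftheta_product_phi (q : C) : pdisc q ->
  ftheta (q ^ 6) (q ^ 8) * ftheta (q ^ 4) (q ^ 10) * ftheta (q ^ 2) (q ^ 12)
    * (psi (q ^ 7) * chi (- q ^ 2) * chi (- q))
  = phi (- q ^ 14) *
    (ftheta (- q) (- q ^ 13) * ftheta (- q ^ 3) (- q ^ 11) * ftheta (- q ^ 5) (- q ^ 9)).
Proof.
intros Hq.
assert (H2 : pdisc (q ^ 2)) by pdisc.
assert (H14 : pdisc (q ^ 14)) by pdisc.
assert (N7 : qpoch_inf (q ^ 7) (q ^ 14) <> 0)
  by (apply qpoch_inf_neq_0; apply pdisc_pow, Hq).
assert (N14 : qpoch_inf (- q ^ 14) (q ^ 14) <> 0)
  by (apply qpoch_inf_neq_0; rewrite ?Cmod_opp; apply H14).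
assert (Chi1 : chi (- q) = qpoch_inf q (q ^ 2)) by (unfold chi; f_equal; ring).
assert (Chi2 : chi (- q ^ 2) = qpoch_inf (q ^ 2) ((q ^ 2) ^ 2)) by (unfold chi; f_equal; ring).
pose proof (psi_prod (q ^ 7) ltac:(pdisc)) as P7.
rewrite <- Cpow_mult_r in P7. simpl Nat.mul in P7.
pose proof (euler_odd_distinct (q ^ 2) (proj2 H2)) as E2. rewrite <- Chi2 in E2.
pose proof (euler_odd_distinct (q ^ 14) (proj2 H14)) as E14.
pose proof (phi_opp_prod (q ^ 14) H14) as P14.
pose proof (ftheta_odd_product q Hq) as To.
pose proof (ftheta_opp_even_product q Hq) as Te.
apply (Cmult_reg_r (qpoch_inf (- q ^ 14) (q ^ 14))); auto.
apply (Cmult_reg_r (qpoch_inf (q ^ 7) (q ^ 14))); auto.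
(* The common value of both sides: Euler's identity removes $\chi(-q^2)(-q^2;q^2)_\infty$ on the
   left and reduces $\phi(-q^{14})(-q^{14};q^{14})_\infty$ to $(q^{14};q^{14})_\infty$ on the
   right. *)
transitivity (qpoch_inf q (q ^ 2) * qpoch_inf (q ^ 14) (q ^ 14) ^ 4).
- transitivity ((chi (- q ^ 2) * qpoch_inf (- q ^ 2) (q ^ 2)) * qpoch_inf q (q ^ 2)
                * qpoch_inf (q ^ 14) (q ^ 14) ^ 3 * (psi (q ^ 7) * qpoch_inf (q ^ 7) (q ^ 14))).
  + rewrite Chi1.
    transitivity (chi (- q ^ 2) * (qpoch_inf (- q ^ 2) (q ^ 2) * qpoch_inf (q ^ 14) (q ^ 14) ^ 3)
                  * qpoch_inf q (q ^ 2) * (psi (q ^ 7) * qpoch_inf (q ^ 7) (q ^ 14))); [|ring].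
    rewrite <- Te. ring.
  + rewrite E2, P7. ring.
- transitivity (phi (- q ^ 14) * qpoch_inf (- q ^ 14) (q ^ 14) *
                (qpoch_inf q (q ^ 2) * qpoch_inf (q ^ 14) (q ^ 14) ^ 3)).
  + rewrite P14.
    transitivity (qpoch_inf (q ^ 14) ((q ^ 14) ^ 2) * qpoch_inf (- q ^ 14) (q ^ 14) *
                  (qpoch_inf q (q ^ 2) * qpoch_inf (q ^ 14) (q ^ 14) ^ 4)); [|ring].
    rewrite E14. ring.
  + rewrite <- To. ring.
Qed.

(* Division by zero yields [0], which is what makes the theorem hold at [q = 0]. *)
Lemma Cdiv_0_r (x : C) : x / 0 = 0.
Proof.
unfold Cdiv, Cinv, Cmult; apply injective_projections; simpl; unfold Rdiv; ring.
Qed.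

Theorem theorem2p2 (q : C) (hq : (Cmod q < 1)%R) :
  (1 / V1 q - V1 q =
    (phi (q ^ 7) * ftheta (- q ^ 6) (- q ^ 8)) /
    (q ^ 3 * psi (q ^ 14) * ftheta (- q) (- q ^ 13))) /\
  (1 / V1 q + V1 q =
    (phi (- q ^ 7) * ftheta (q ^ 6) (q ^ 8)) /
    (q ^ 3 * psi (q ^ 14) * ftheta (- q) (- q ^ 13))) /\
  (1 / V2 q - V2 q =
    (phi (q ^ 7) * ftheta (- q ^ 4) (- q ^ 10)) /
    (q ^ 2 * psi (q ^ 14) * ftheta (- q ^ 3) (- q ^ 11))) /\
  (1 / V2 q + V2 q =
    (phi (- q ^ 7) * ftheta (q ^ 4) (q ^ 10)) /
    (q ^ 2 * psi (q ^ 14) * ftheta (- q ^ 3) (- q ^ 11))) /\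
  (1 / V3 q - V3 q =
    (phi (q ^ 7) * ftheta (- q ^ 2) (- q ^ 12)) /
    (q * psi (q ^ 14) * ftheta (- q ^ 5) (- q ^ 9))) /\
  (1 / V3 q + V3 q =
    (phi (- q ^ 7) * ftheta (q ^ 2) (q ^ 12)) /
    (q * psi (q ^ 14) * ftheta (- q ^ 5) (- q ^ 9))) /\
  ((1 / V1 q - V1 q) * (1 / V2 q - V2 q) * (1 / V3 q - V3 q) =
    (phi (q ^ 7) ^ 3 * psi q) /
    (q ^ 6 * psi (q ^ 14) ^ 3 * psi (q ^ 7))) /\
  ((1 / V1 q + V1 q) * (1 / V2 q + V2 q) * (1 / V3 q + V3 q) =
    (phi (- q ^ 7) ^ 3 * phi (- q ^ 14)) /
    (q ^ 6 * psi (q ^ 14) ^ 3 * psi (q ^ 7) * chi (- q ^ 2) * chi (- q))).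
Proof.
destruct (Ceq_dec q 0) as [-> | Hq0].
{ unfold V1, V2, V3.
  assert (Z : forall n, (RtoC 0) ^ S n = 0) by (intros n; rewrite Cpow_S; ring).
  rewrite ?Z, ?Cmult_0_l, ?Cdiv_0_r. repeat split; ring. }
assert (Hq : pdisc q) by now split.
(* The pairs [(3, 1)], [(2, 3)], [(1, 5)] all satisfy $2m+k=7$, which is why $\phi(\pm q^7)$ and
   $\psi(q^{14})$ are common to all six identities. *)
pose proof (quotient_minus_pow q 3 1 ltac:(pdisc) ltac:(pdisc)) as I1.
pose proof (quotient_plus_pow q 3 1 ltac:(pdisc) ltac:(pdisc)) as I2.
pose proof (quotient_minus_pow q 2 3 ltac:(pdisc) ltac:(pdisc)) as I3.
pose proof (quotient_plus_pow q 2 3 ltac:(pdisc) ltac:(pdisc)) as I4.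
pose proof (quotient_minus_pow q 1 5 ltac:(pdisc) ltac:(pdisc)) as I5.
pose proof (quotient_plus_pow q 1 5 ltac:(pdisc) ltac:(pdisc)) as I6.
cbv zeta in *. simpl Nat.add in *. simpl Nat.mul in *. rewrite Cpow_1_r in *.
fold (V1 q) in I1, I2. fold (V2 q) in I3, I4. fold (V3 q) in I5, I6.
assert (Hpsi : forall k, psi (q ^ S k) <> 0).
{ intros k. unfold psi. apply ftheta_neq_0; pdisc. }
assert (T1 : ftheta (- q) (- q ^ 13) <> 0) by (apply ftheta_neq_0; pdisc).
assert (T3 : ftheta (- q ^ 3) (- q ^ 11) <> 0) by (apply ftheta_neq_0; pdisc).
assert (T5 : ftheta (- q ^ 5) (- q ^ 9) <> 0) by (apply ftheta_neq_0; pdisc).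
repeat (split; [assumption|]). split.
- rewrite I1, I3, I5.
  (* The fraction is expanded by [psi (q ^ 7)] and its theta functions gathered, to expose the left
     side of [ftheta_product_psi]. *)
  transitivity (phi (q ^ 7) ^ 3 *
    (ftheta (- q ^ 6) (- q ^ 8) * ftheta (- q ^ 4) (- q ^ 10) * ftheta (- q ^ 2) (- q ^ 12)
     * psi (q ^ 7)) /
    (q ^ 6 * psi (q ^ 14) ^ 3 * psi (q ^ 7) *
     (ftheta (- q) (- q ^ 13) * ftheta (- q ^ 3) (- q ^ 11) * ftheta (- q ^ 5) (- q ^ 9)))).
  + field. repeat split; auto.
  + rewrite ftheta_product_psi by auto. field. repeat split; auto.
- assert (Chi1 : chi (- q) <> 0).
  { unfold chi. apply qpoch_inf_neq_0; [apply pdisc_pow | rewrite Cmod_opp; apply pdisc_opp]; pdisc. }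
  assert (Chi2 : chi (- q ^ 2) <> 0).
  { unfold chi. apply qpoch_inf_neq_0; [apply pdisc_pow | rewrite Cmod_opp; apply pdisc_opp]; pdisc. }
  rewrite I2, I4, I6.
  transitivity (phi (- q ^ 7) ^ 3 *
    (ftheta (q ^ 6) (q ^ 8) * ftheta (q ^ 4) (q ^ 10) * ftheta (q ^ 2) (q ^ 12)
     * (psi (q ^ 7) * chi (- q ^ 2) * chi (- q))) /
    (q ^ 6 * psi (q ^ 14) ^ 3 * (psi (q ^ 7) * chi (- q ^ 2) * chi (- q)) *
     (ftheta (- q) (- q ^ 13) * ftheta (- q ^ 3) (- q ^ 11) * ftheta (- q ^ 5) (- q ^ 9)))).
  + field. repeat split; auto.
  + rewrite ftheta_product_phi by auto. field. repeat split; auto.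
Qed.
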